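(* Let $\mathcal{X}$ be a complex Banach space with $\dim \mathcal{X}\geq 2$, let $\mathcal{U}\subseteq B(\mathcal{X})$ be a standard operator algebra containing the identity operator $I$, let $n\geq 2$ be a fixed integer, and let $\phi:\mathcal{U}\rightarrow\mathcal{U}$ be a linear map. The following are equivalent: (i) $\phi$ satisfies $\mathbf{(N)}$; (ii) $\phi$ satisfies $\mathbf{(N_l)}$; (iii) $\phi$ satisfies $\mathbf{(N_r)}$; (iv) there exist an element $\lambda\in\mathbb{C}$ and a linear map $\mu:\mathcal{U}\rightarrow\mathbb{C}$ such that $\phi(A)=\lambda A+\mu(A)I$ for all $A\in\mathcal{U}$ and $\mu(p_n(A_1,A_2,\dots,A_n))=0$ for all $A_1,A_2,\dots,A_n\in\mathcal{U}$ with $A_1A_2\cdots A_n=0$.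
   Context: All algebras and vector spaces are over $\mathbb{C}$. For a complex Banach space $\mathcal{X}$, $B(\mathcal{X})$ is the algebra of all bounded linear operators on $\mathcal{X}$ and $F(\mathcal{X})$ is its ideal of finite rank operators. A standard operator algebra over $\mathcal{X}$ is any subalgebra of $B(\mathcal{X})$ containing $F(\mathcal{X})$ (no closedness is assumed). For elements of an algebra $\mathcal{U}$, $[a,b]=ab-ba$, and $p_n$ is defined recursively by $p_1(a_1)=a_1$ and $p_n(a_1,\dots,a_n)=[p_{n-1}(a_1,\dots,a_{n-1}),a_n]$ for $n\geq 2$. For a fixed integer $n\geq 2$ and a linear map $\phi:\mathcal{U}\to\mathcal{U}$, consider the following conditions: - $\mathbf{(N_l)}$: $\phi(p_n(a_1,a_2,\dots,a_n))=p_n(\phi(a_1),a_2,\dots,a_n)$ for all $a_1,\dots,a_n\in\mathcal{U}$ with $a_1a_2\cdots a_n=0$. - $\mathbf{(N_r)}$: $\phi(p_n(a_1,a_2,\dots,a_n))=p_n(a_1,\phi(a_2),a_3,\dots,a_n)$ for all $a_1,\dots,a_n\in\mathcal{U}$ with $a_1a_2\cdots a_n=0$. - $\mathbf{(N)}$: both $\mathbf{(N_l)}$ and $\mathbf{(N_r)}$ hold. *)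

(* Defs.v *)
From HB Require Import structures.
From mathcomp Require Import all_boot all_order all_algebra.
From mathcomp Require Import complex.
From mathcomp Require Import boolp classical_sets functions reals topology normedtype.

Set Implicit Arguments.
Unset Strict Implicit.
Unset Printing Implicit Defensive.

Import Order.TTheory GRing.Theory Num.Theory.
Import numFieldNormedType.Exports.

Local Open Scope ring_scope.

(* [algType] requires 1 != 0, which fails in B(0), so B(V) and its subalgebras
   only get [pzRingType] and [lmodType] structures; their compatibility is
   bop_scalerAl and bop_scalerAr. *)

Section LieProducts.
Variable U : pzRingType.

Definition lie (a b : U) : U := a * b - b * a.

(* p_n(a_1, ..., a_n), with n the size of the sequence; the value at [::] is
   irrelevant.  The recursion is that of lie_poly1 and lie_poly_rcons. *)
Definition lie_poly (s : seq U) : U :=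
  if s is a :: s' then foldl lie a s' else 0.

Lemma lie_poly1 (a : U) : lie_poly [:: a] = a.
Proof. by []. Qed.

Lemma lie_poly_rcons (s : seq U) (b : U) :
  (0 < size s)%N -> lie_poly (rcons s b) = lie (lie_poly s) b.
Proof. by case: s => //= a s _; rewrite foldl_rcons. Qed.

Variables (n : nat) (phi : U -> U).

Definition condNl : Prop := forall (a1 a2 : U) (s : seq U),
  size [:: a1, a2 & s] = n -> \prod_(a <- [:: a1, a2 & s]) a = 0 ->
  phi (lie_poly [:: a1, a2 & s]) = lie_poly [:: phi a1, a2 & s].

Definition condNr : Prop := forall (a1 a2 : U) (s : seq U),
  size [:: a1, a2 & s] = n -> \prod_(a <- [:: a1, a2 & s]) a = 0 ->
  phi (lie_poly [:: a1, a2 & s]) = lie_poly [:: a1, phi a2 & s].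

Definition condN : Prop := condNl /\ condNr.

End LieProducts.

Definition dim_ge (K : pzRingType) (V : lmodType K) (m : nat) : Prop :=
  exists e : 'I_m -> V, forall c : 'I_m -> K,
    \sum_i c i *: e i = 0 -> forall i, c i = 0.

Section BoundedOperators.
Variables (K : numFieldType) (V : normedModType K).

Definition bounded_op (f : V -> V) : Prop :=
  exists M : K, forall x : V, `|f x| <= M * `|x|.

Lemma bounded_opP (f : {linear V -> V}) : bounded_op f <-> continuous f.
Proof.
rewrite -linear_bounded_continuous linear_boundedP; split.
  case=> M Mf; exists `|M|; split; first exact: normr_real.
  move=> r /= Mr x; apply: (le_trans (Mf x)).
  have M0 : 0 <= M * `|x| by exact: le_trans (normr_ge0 _) (Mf x).
  by rewrite -(ger0_norm M0) normrM normr_id ler_wpM2r// ltW.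
case=> M [Mreal Mf]; exists (M + 1) => x; apply: Mf.
by rewrite ltrDl ltr01.
Qed.

Definition is_bop : {pred V -> V} :=
  fun f => `[< linear f /\ bounded_op f >].

(* B(V) *)
Record bop := BOp { bop_fun :> V -> V; bop_prop : bop_fun \in is_bop }.

HB.instance Definition _ := [isSub for bop_fun].
HB.instance Definition _ := [Choice of bop by <:].

Lemma is_bopP (f : V -> V) :
  reflect (linear f /\ bounded_op f) (f \in is_bop).
Proof. exact: asboolP. Qed.

Lemma bop_linear (A : bop) : linear A.
Proof. by case/is_bopP: (bop_prop A). Qed.

Lemma bop_bounded (A : bop) : bounded_op A.
Proof. by case/is_bopP: (bop_prop A). Qed.

HB.instance Definition _ (A : bop) :=
  GRing.isLinear.Build K V V *:%R A (@bop_linear A).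

Lemma bop_ext (A B : bop) : (forall x, A x = B x) -> A = B.
Proof. by move=> AB; apply: val_inj; apply: funext. Qed.

Lemma is_bop_submod : submod_closed is_bop.
Proof.
split.
  apply/is_bopP; split; first by move=> a x y /=; rewrite scaler0 addr0.
  by exists 0 => x; rewrite mul0r normr0.
move=> a f g /is_bopP[lf [Mf bf]] /is_bopP[lg [Mg bg]]; apply/is_bopP; split.
  move=> b x y.
  have E z : (a *: f + g) z = a *: f z + g z by [].
  by rewrite !E lf lg !scalerDr !scalerA (mulrC b) addrACA.
exists (`|a| * Mf + Mg) => x.
have -> : (a *: f + g) x = a *: f x + g x by [].
rewrite (le_trans (ler_normD _ _))// normrZ mulrDl lerD// -mulrA.
by rewrite ler_wpM2l.
Qed.

HB.instance Definition _ :=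
  GRing.isSubmodClosed.Build K (V -> V) is_bop is_bop_submod.
HB.instance Definition _ := [SubChoice_isSubLmodule of bop by <:].

Lemma is_bop_id : (@id V) \in is_bop.
Proof.
apply/is_bopP; split; first by [].
by exists 1 => x; rewrite mul1r.
Qed.

Lemma is_bop_comp (A B : bop) : (fun x => A (B x)) \in is_bop.
Proof.
apply/is_bopP; split; first by move=> a x y; rewrite !linearP.
have [[M bA] [N bB]] := (bop_bounded A, bop_bounded B).
exists (`|M| * N) => x; rewrite (le_trans (bA _))//.
have M0 : 0 <= M * `|B x| by exact: le_trans (normr_ge0 _) (bA _).
by rewrite -(ger0_norm M0) normrM normr_id -mulrA ler_wpM2l.
Qed.

Definition bop1 : bop := BOp is_bop_id.
Definition bop_mul (A B : bop) : bop := BOp (is_bop_comp A B).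

Lemma bopDE (A B : bop) x : (A + B) x = A x + B x. Proof. by []. Qed.
Lemma bopNE (A : bop) x : (- A) x = - A x. Proof. by []. Qed.
Lemma bopZE (a : K) (A : bop) x : (a *: A) x = a *: A x. Proof. by []. Qed.

Fact bop_mulA : associative bop_mul.
Proof. by move=> A B D; apply: bop_ext. Qed.
Fact bop_mul1l : left_id bop1 bop_mul.
Proof. by move=> A; apply: bop_ext. Qed.
Fact bop_mul1r : right_id bop1 bop_mul.
Proof. by move=> A; apply: bop_ext. Qed.
Fact bop_mulDl : left_distributive bop_mul +%R.
Proof. by move=> A B D; apply: bop_ext. Qed.
Fact bop_mulDr : right_distributive bop_mul +%R.
Proof. by move=> A B D; apply: bop_ext => x; exact: (linearD A (B x) (D x)). Qed.

HB.instance Definition _ := GRing.Zmodule_isPzRing.Build bop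
  bop_mulA bop_mul1l bop_mul1r bop_mulDl bop_mulDr.

Lemma bop1E x : (1 : bop) x = x. Proof. by []. Qed.
Lemma bopME (A B : bop) x : (A * B) x = A (B x). Proof. by []. Qed.

Lemma bop_scalerAl (a : K) (A B : bop) : a *: (A * B) = (a *: A) * B.
Proof. by apply: bop_ext. Qed.
Lemma bop_scalerAr (a : K) (A B : bop) : a *: (A * B) = A * (a *: B).
Proof. by apply: bop_ext => x; rewrite /= -[RHS]/(A (a *: B x)) linearZ. Qed.

Definition finite_rank (A : bop) : Prop :=
  exists (m : nat) (e : 'I_m -> V), forall x : V,
    exists c : 'I_m -> K, A x = \sum_i c i *: e i.

(* A subalgebra is not required to contain the identity. *)
Definition standard_operator_algebra (S : {pred bop}) : Prop :=
  [/\ submod_closed S, GRing.mulr_2closed S &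
      forall A : bop, finite_rank A -> A \in S].

(* The members of a standard operator algebra containing I, as a type *)
Section UnitalSubalgebra.
Variables (S : {pred bop}) (hS : standard_operator_algebra S) (hI : 1 \in S).

Definition soa_pred (_ : standard_operator_algebra S) (_ : 1 \in S) :
  {pred bop} := S.
Local Notation P := (soa_pred hS hI).

Fact soa_submod : submod_closed P.
Proof. by case: hS. Qed.

Fact soa_subring : subring_closed P.
Proof.
have [[S0 Slin] SM _] := hS; split => //.
by apply: GRing.linear_closedB.
Qed.


Record soa := SOA { soa_val :> bop; soa_prop : soa_val \in P }.

HB.instance Definition _ := [isSub for soa_val].
HB.instance Definition _ := [Choice of soa by <:].
HB.instance Definition _ :=
  GRing.SubChoice_isSubPzRing.Build bop P soa soa_subring.
HB.instance Definition _ :=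
  GRing.SubZmodule_isSubLmodule.Build K bop P soa soa_submod.

Lemma soa_val1 : soa_val 1 = 1. Proof. by []. Qed.
Lemma soa_valD (A B : soa) : soa_val (A + B) = soa_val A + soa_val B.
Proof. by []. Qed.
Lemma soa_valM (A B : soa) : soa_val (A * B) = soa_val A * soa_val B.
Proof. by []. Qed.
Lemma soa_valZ (a : K) (A : soa) : soa_val (a *: A) = a *: soa_val A.
Proof. by []. Qed.

Lemma soa_scalerAl (a : K) (A B : soa) : a *: (A * B) = (a *: A) * B.
Proof. by apply: val_inj; exact: bop_scalerAl. Qed.
Lemma soa_scalerAr (a : K) (A B : soa) : a *: (A * B) = A * (a *: B).
Proof. by apply: val_inj; exact: bop_scalerAr. Qed.

End UnitalSubalgebra.

End BoundedOperators.

(* Main.v *)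
Require Import Defs.
From HB Require Import structures.
From mathcomp Require Import all_boot all_order all_algebra.
From mathcomp Require Import complex.
From mathcomp Require Import boolp classical_sets functions reals topology normedtype.
From mathcomp Require Import ring lra.

Set Implicit Arguments.
Unset Strict Implicit.
Unset Printing Implicit Defensive.

Import Order.TTheory GRing.Theory Num.Theory.
Import numFieldNormedType.Exports.

Local Open Scope ring_scope.

(** Either Lie condition forces a much weaker looking one: if [A * B] and
    [B * A] both vanish, the commutator of [phi A] with [B] is a scalar
    operator ([lie_orthogonal]).  The iterated commutator that starts with
    [A], [B] or [B], [A] is then 0 for every choice of its further entries,
    hence so is the one with [phi A] in place of [A]; and an operator all of whose
    iterated commutators of some length vanish is scalar
    ([foldl_lie_is_scalar]).  A [lie_orthogonal] map is affine, of
    the form [l A + mu(A) I] ([lie_orthogonal_affine]), and for an affine map each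
    of the two Lie conditions amounts to the vanishing of [mu] on the
    commutators in question ([affine_condNlP], [affine_condNrP]).

    That a [lie_orthogonal] map is affine is read off from the idempotents
    [P] of rank one.  The image of [P] is scalar on the range of [P] and on its
    kernel, so that [phi P = l P + m] ([rank_one_idempotent_affine]).  The
    coefficient [l] is the same for all [P], as one sees from midpoints of
    idempotents with the same range or the same kernel
    ([rank_one_idempotent_slope]).  After subtracting [l id], every operator
    of rank one has a scalar image, and an operator [A] may be replaced by
    its corner [(1 - P) A (1 - P)], which is orthogonal to [P].  So the
    image of [A] commutes with every [P] and is scalar
    ([scalar_on_idempotents_is_scalar]).

    The supply of rank one operators rests on the existence of a bounded
    functional with value 1 at a given nonzero vector.  It comes from the real
    Hahn-Banach theorem, proved by descending to a minimal sublinear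
    functional, which is linear: this handles total functions only, instead
    of partial extensions. *)

(** * Dominated linear functionals on real vector spaces *)

Section HahnBanach.
Local Open Scope classical_set_scope.
Variables (R : realType) (V : lmodType R).
Implicit Types (p q : V -> R) (x y : V) (E : V -> set R).

Definition sublinear p : Prop :=
  (forall x y, p (x + y) <= p x + p y) /\
  (forall (t : R) x, 0 < t -> p (t *: x) <= t * p x).

Lemma sublinear0 p : sublinear p -> p 0 = 0.
Proof.
case=> pD pZ; have h := pD 0 0; have k := pZ 2^-1 0.
rewrite addr0 scaler0 in h k; have := k ltac:(lra).
by lra.
Qed.

Lemma sublinearZ p t x : sublinear p -> 0 < t -> p (t *: x) = t * p x.
Proof.
move=> [pD pZ] t0; apply/le_anti/andP; split; first exact: pZ.
have := pZ t^-1 (t *: x); rewrite invr_gt0 => /(_ t0).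
by rewrite scalerA mulVf ?gt_eqF// scale1r mulrC ler_pdivlMr// mulrC.
Qed.

Lemma sublinear_lb p x : sublinear p -> - p (- x) <= p x.
Proof.
move=> sp; have := sublinear0 sp; case: sp => pD _ p0.
by have := pD x (- x); rewrite subrr p0; lra.
Qed.

(** [E x] lists the admissible upper estimates at [x]; each of the two
    inequalities passes to the infimum because estimates at [x] and [y]
    combine into one at [x + y], and scale along with [x]. *)
Lemma inf_sublinear E :
  (forall x, has_inf (E x)) ->
  (forall x y a b, E x a -> E y b -> exists2 c, E (x + y) c & c <= a + b) ->
  (forall (t : R) x a, 0 < t -> E x a -> exists2 c, E (t *: x) c & c <= t * a) ->
  sublinear (fun x => inf (E x)).
Proof.
move=> Einf ED EZ.
have infE x a : E x a -> inf (E x) <= a.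
  by move=> Exa; apply: ge_inf => //; case: (Einf x).
have le_infE x m : (forall a, E x a -> m <= a) -> m <= inf (E x).
  by move=> mE; apply: lb_le_inf => //; case: (Einf x).
split=> [x y|t x t0].
  rewrite -lerBlDr; apply: (le_infE) => a Exa.
  rewrite lerBlDr -lerBlDl; apply: (le_infE) => b Eyb.
  rewrite lerBlDl; have [c Ec cab] := ED _ _ _ _ Exa Eyb.
  exact: le_trans (infE _ _ Ec) cab.
rewrite -ler_pdivrMl//; apply: (le_infE) => a Exa; rewrite ler_pdivrMl//.
have [c Ec ct] := EZ _ _ _ t0 Exa.
exact: le_trans (infE _ _ Ec) ct.
Qed.

(** The infimum over [0 <= t] of [p (x + t *: y) - t * p y] is the
    sublinear functional obtained from [p] by translations along [y]; the
    term [t = 1] bounds its value at [- y].  It serves twice: to see that a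
    minimal functional is odd, and to start the descent below [p] from a
    functional that already pins the value at a chosen vector. *)
Lemma sublinear_descent p y : sublinear p -> exists q,
  [/\ sublinear q, forall x, q x <= p x & q (- y) <= - p y].
Proof.
move=> sp; have := sublinear0 sp; have pN := sublinear_lb _ sp.
have [pD pZ] := sp => p0.
pose E x := [set p (x + t *: y) - t * p y | t in [set t : R | 0 <= t]].
have Einf x : has_inf (E x).
  split; first by exists (p (x + 0 *: y) - 0 * p y), 0 => //=.
  exists (- p (- x)) => _ [t /= t0 <-].
  have := pD (x + t *: y) (- x); rewrite addrAC subrr add0r.
  have -> : p (t *: y) = t * p y.
    move: t0; rewrite le_eqVlt => /predU1P[<-|]; last exact: sublinearZ.
    by rewrite scale0r mul0r.
  by lra.
have infE x t : 0 <= t -> inf (E x) <= p (x + t *: y) - t * p y.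
  by move=> t0; apply: ge_inf; [case: (Einf x)|exists t].
exists (fun x => inf (E x)); split.
- apply: inf_sublinear => //.
    move=> x z _ _ [s /= s0 <-] [t /= t0 <-].
    exists (p (x + z + (s + t) *: y) - (s + t) * p y).
      by exists (s + t) => //=; rewrite addr_ge0.
    have := pD (x + s *: y) (z + t *: y); rewrite addrACA -scalerDl; lra.
  move=> t x _ t0 [s /= s0 <-].
  exists (p (t *: x + (t * s) *: y) - (t * s) * p y).
    by exists (t * s) => //=; rewrite mulr_ge0// ltW.
  by rewrite -scalerA -scalerDr mulrBr mulrA lerB// pZ.
- by move=> x; have := infE x 0 (lexx _); rewrite scale0r addr0 mul0r subr0.
- by have := infE (- y) 1 ler01; rewrite scale1r addNr p0 mul1r sub0r.
Qed.

(** Zorn's lemma applies since every sublinear [q] below [p] satisfies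
    [- p (- x) <= q x], so that the pointwise infimum of a chain is finite;
    being a chain makes it subadditive. *)
Lemma minimal_sublinear_exists p : sublinear p -> exists q,
  [/\ sublinear q, forall x, q x <= p x &
      forall r, sublinear r -> (forall x, r x <= q x) -> r = q].
Proof.
move=> sp; pose T := {q | sublinear q /\ forall x, q x <= p x}.
pose below (q r : T) : bool := `[< forall x, sval r x <= sval q x >].
pose inT q sq qp : T := exist _ q (conj sq qp).
have t0 : T by exists p.
have lbT (q : T) x : - p (- x) <= sval q x.
  case: q => q [sq qp] /=; apply: le_trans (sublinear_lb x sq).
  by rewrite lerN2.
have [] := @Zorn T below.
- by move=> q; apply/asboolP.
- move=> q r s /asboolP qr /asboolP rs; apply/asboolP => x.
  exact: le_trans (rs x) (qr x).
- move=> [q Pq] [r Pr] /asboolP /= qr /asboolP /= rq.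
  by apply: eq_exist; apply: funext => x; apply/le_anti; rewrite qr rq.
- move=> A chainA; have [[a0 Aa0]|] := pselect (exists a, A a); last first.
    by move=> A0; exists t0 => s As; case: A0; exists s.
  pose E x := [set sval a x | a in A].
  have Einf x : has_inf (E x).
    split; first by exists (sval a0 x), a0.
    by exists (- p (- x)) => _ [a _ <-].
  have infE a x : A a -> inf (E x) <= sval a x.
    by move=> Aa; apply: ge_inf; [case: (Einf x)|exists a].
  have sinf : sublinear (fun x => inf (E x)).
    apply: inf_sublinear => //.
      move=> x y _ _ [a Aa <-] [b Ab <-].
      have [/asboolP ab|/asboolP ba] := chainA _ _ Aa Ab.
        exists (sval b (x + y)); first by exists b.
        by apply: le_trans (proj1 (proj1 (svalP b)) x y) _; rewrite lerD2r.
      exists (sval a (x + y)); first by exists a.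
      by apply: le_trans (proj1 (proj1 (svalP a)) x y) _; rewrite lerD2l.
    move=> t x _ t_gt0 [a Aa <-]; exists (sval a (t *: x)); first by exists a.
    exact: (proj2 (proj1 (svalP a))).
  have infp x : inf (E x) <= p x.
    by apply: le_trans (infE a0 x Aa0) (proj2 (svalP a0) x).
  exists (inT _ sinf infp) => s As.
  by apply/asboolP => x; exact: infE.
move=> [q [sq qp]] qmin; exists q; split=> // r sr rq.
have rp x : r x <= p x by exact: le_trans (rq x) (qp x).
have /qmin /(congr1 sval) // :
  below (inT q sq qp) (inT r sr rp).
exact/asboolP.
Qed.

(** By minimality, [sublinear_descent] in the direction [x] returns [q]
    itself, whence [q (- x) <= - q x].  An odd subadditive function is
    additive. *)
Lemma minimal_sublinear_scalar q : sublinear q ->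
  (forall r, sublinear r -> (forall x, r x <= q x) -> r = q) -> scalar q.
Proof.
move=> sq qmin; have [qD qZ] := sq.
have qN x : q (- x) = - q x.
  have [r [sr rq rx]] := sublinear_descent x sq.
  move: rx; rewrite (qmin _ sr rq) => h.
  by have := sublinear_lb x sq; lra.
have qDE x y : q (x + y) = q x + q y.
  have := qD (x + y) (- y); rewrite addrK qN; have := qD x y; lra.
move=> a x y; rewrite qDE; congr (_ + _).
have [a0|a0|->] := ltgtP a 0; last by rewrite scale0r mul0r sublinear0.
  by rewrite -[in LHS](opprK a) scaleNr qN sublinearZ ?oppr_gt0// mulNr opprK.
exact: sublinearZ.
Qed.

(** A linear functional below [p] need not touch [p] at [x0]; the descent
    in the direction [x0] first brings the value at [- x0] down to [- p x0],
    and oddness then forces equality. *)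
Lemma hahn_banach p x0 : sublinear p -> exists q : V -> R,
  [/\ scalar q, forall x, q x <= p x & q x0 = p x0].
Proof.
move=> sp; have [r [sr rp rx0]] := sublinear_descent x0 sp.
have [q [sq qr qmin]] := minimal_sublinear_exists sr.
have lq := minimal_sublinear_scalar sq qmin.
have qp x : q x <= p x by exact: le_trans (qr x) (rp x).
exists q; split=> //; apply/le_anti; rewrite qp /=.
have qN : q (- x0) = - q x0.
  by have := lq (-1) x0 0; rewrite scaleN1r addr0 mulN1r sublinear0// addr0.
by have := qr (- x0); rewrite qN; lra.
Qed.

End HahnBanach.

(** * Bounded functionals on complex normed spaces *)

(** An alias of [X], so that the scaling by reals does not compete with the
    scaling by complex numbers on [X]. *)
Definition restrict_scalars (R : rcfType) (X : Type) : Type := X.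

Section RestrictScalars.
Variables (R : rcfType) (X : lmodType R[i]).
Local Notation XR := (restrict_scalars R X).

HB.instance Definition _ := GRing.Zmodule.on XR.

Definition real_scale (t : R) (x : XR) : XR := t%:C%C *: (x : X).

Fact real_scalerA a b v : real_scale a (real_scale b v) = real_scale (a * b) v.
Proof. by rewrite /real_scale scalerA rmorphM. Qed.
Fact real_scale1r : left_id 1 real_scale.
Proof. by move=> v; rewrite /real_scale scale1r. Qed.
Fact real_scalerDr : right_distributive real_scale +%R.
Proof. by move=> a v w; exact: scalerDr. Qed.
Fact real_scalerDl v : {morph real_scale^~ v : a b / a + b}.
Proof. by move=> a b; rewrite /real_scale rmorphD /= scalerDl. Qed.

HB.instance Definition _ := GRing.Zmodule_isLmodule.Build R XR
  real_scalerA real_scale1r real_scalerDr real_scalerDl.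

End RestrictScalars.

Section BoundedFunctionals.
Variables (R : realType) (X : normedModType R[i]).
Local Notation XR := (restrict_scalars R X).

Let realnorm (y : XR) : R := complex.Re `|y : X|.

Let realnormE (y : X) : (realnorm y)%:C%C = `|y|.
Proof. by rewrite RRe_real ?normr_real. Qed.

Lemma sublinear_norm : sublinear realnorm.
Proof.
split=> [y z|t y t0]; rewrite -lecR.
  by rewrite rmorphD /= !realnormE ler_normD.
by rewrite rmorphM /= !realnormE normrZ ger0_norm// lecR ltW.
Qed.

(** A real functional [u] dominated by the norm is the real part of the complex
    one [y |-> u y - i u (i y)], which is bounded by twice the norm.  It does
    not vanish at [x], where [u] is the norm of [x]. *)
Lemma bounded_functional_exists (x : X) : x != 0 ->
  exists f : X -> R[i],
    [/\ scalar f, exists M, forall y, `|f y| <= M * `|y| & f x = 1].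
Proof.
move=> x0; have [u [ulin up ux]] := hahn_banach (x : XR) sublinear_norm.
have uD (y z : X) : u (y + z) = u y + u z.
  by have := ulin 1 y z; rewrite scale1r mul1r.
have u0 : u 0 = 0 by apply: (addrI (u 0)); rewrite -uD !addr0.
have uZ t (y : X) : u (t%:C%C *: y) = t * u y.
  by have := ulin t y 0; rewrite !addr0 u0 addr0.
have uN (y : X) : u (- y) = - u y.
  by have := uZ (-1) y; rewrite rmorphN1 scaleN1r mulN1r.
have uB (y : X) : `|u y|%:C%C <= `|y|.
  rewrite -realnormE lecR ler_norml up andbT lerNl -uN.
  by rewrite (le_trans (up _))// /realnorm normrN.
pose F (y : X) : R[i] := (u y +i* - u ('i%C *: y))%C.
have FD y z : F (y + z) = F y + F z.
  by rewrite /F scalerDr !uD opprD.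
have FZ a y : F (a *: y) = a * F y.
  have uM (b : R[i]) :
      u (b *: y) = complex.Re b * u y + complex.Im b * u ('i%C *: y).
    by rewrite {1}[b]complexE scalerDl uD uZ (mulrC 'i%C) -scalerA uZ.
  rewrite /F scalerA (uM a) (uM ('i%C * a)); case: a => s t /=; simpc.
  by congr (_ +i* _)%C; ring.
have Fx0 : F x != 0.
  have px0 : realnorm x != 0.
    by apply: contraNneq x0 => px0; rewrite -normr_eq0 -realnormE px0.
  by rewrite /F eq_complex /= negb_and ux px0.
exists (fun y => (F x)^-1 * F y); split.
- by move=> a y z; rewrite FD FZ mulrDr mulrCA.
- exists (`|F x|^-1 * 2%:R) => y; rewrite normrM normfV -mulrA.
  rewrite ler_wpM2l ?invr_ge0// mulr_natl mulr2n.
  have -> : F y = (u y)%:C%C - 'i%C * (u ('i%C *: y))%:C%C.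
    by rewrite /F; simpc.
  rewrite (le_trans (ler_normB _ _))// normrM.
  have n1 : `|'i%C : R[i]| = 1 by rewrite normc_def /= expr0n expr1n add0r sqrtr1.
  have nR (r : R) : `|r%:C%C| = `|r|%:C%C.
    by rewrite normc_def /= expr0n addr0 sqrtr_sqr.
  rewrite n1 mul1r !nR lerD ?uB//.
  by rewrite (le_trans (uB _))// normrZ n1 mul1r.
- by rewrite mulVf.
Qed.

End BoundedFunctionals.

(** * Bounded functionals and rank one operators *)

Section Dual.
Variables (K : numFieldType) (V : normedModType K).

Record dual := Dual {
  dual_fun :> V -> K;
  dual_scalar : scalar dual_fun;
  dual_bounded : exists M, forall x, `|dual_fun x| <= M * `|x| }.

HB.instance Definition _ (f : dual) :=
  GRing.isLinear.Build K V K *%R f (@dual_scalar f).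

Lemma dualD (f : dual) x y : f (x + y) = f x + f y. Proof. exact: linearD. Qed.
Lemma dualB (f : dual) x y : f (x - y) = f x - f y. Proof. exact: linearB. Qed.
Lemma dualZ (f : dual) a x : f (a *: x) = a * f x. Proof. exact: linearZ. Qed.

Lemma dual_lincomb (a b : K) (f g : dual) :
  exists h : dual, forall x, h x = a * f x + b * g x.
Proof.
have hlin : scalar (fun x => a * f x + b * g x).
  by move=> c x y; rewrite !linearP /=; ring.
suff hbd : exists M, forall x, `|a * f x + b * g x| <= M * `|x|.
  by exists (Dual hlin hbd).
have [[M fM] [N gN]] := (dual_bounded f, dual_bounded g).
exists (`|a| * M + `|b| * N) => x; rewrite (le_trans (ler_normD _ _))//.
by rewrite mulrDl lerD// normrM -mulrA ler_wpM2l.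
Qed.

Lemma dual_comp (f : dual) (A : bop V) : exists h : dual, forall x, h x = f (A x).
Proof.
have hlin : scalar (fun x => f (A x)) by move=> b x y; rewrite !linearP.
suff hbd : exists M, forall x, `|f (A x)| <= M * `|x|.
  by exists (Dual hlin hbd).
have [[M fM] [N AN]] := (dual_bounded f, bop_bounded A).
exists (`|M| * N) => x; rewrite (le_trans (fM _))//.
have M0 : 0 <= M * `|A x| by exact: le_trans (normr_ge0 _) (fM _).
by rewrite -(ger0_norm M0) normrM normr_id -mulrA ler_wpM2l.
Qed.

Lemma dyad_is_bop (x : V) (f : dual) : (fun v => f v *: x) \in @is_bop K V.
Proof.
apply/is_bopP; split=> [a v w|]; first by rewrite linearP scalerDl scalerA.
have [M fM] := dual_bounded f; exists (M * `|x|) => v.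
by rewrite normrZ mulrAC ler_wpM2r.
Qed.

Lemma dyad_finite_rank (x : V) (f : dual) : finite_rank (BOp (dyad_is_bop x f)).
Proof.
by exists 1%N, (fun=> x) => v; exists (fun=> f v); rewrite big_ord1.
Qed.

End Dual.

Section StandardOperatorAlgebra.
Variables (K : numFieldType) (V : normedModType K).
Variables (S : {pred bop V}) (hS : standard_operator_algebra S) (hI : 1 \in S).
Local Notation U := (soa hS hI).
Implicit Types (x y z : V) (f g h : dual V) (A B P Q T : U) (c l : K).

Lemma soa_ext A B : (forall x, A x = B x) -> A = B.
Proof. by move=> AB; apply: val_inj; exact: bop_ext. Qed.

Lemma soaDE A B x : (A + B) x = A x + B x. Proof. by []. Qed.
Lemma soaNE A x : (- A) x = - A x. Proof. by []. Qed.
Lemma soaZE c A x : (c *: A) x = c *: A x. Proof. by []. Qed.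
Lemma soaME A B x : (A * B) x = A (B x). Proof. by []. Qed.
Lemma soa1E x : (1 : U) x = x. Proof. by []. Qed.
Definition soaE := (soaDE, soaNE, soaZE, soaME, soa1E).

Fact dyad_in_soa x f : BOp (dyad_is_bop x f) \in soa_pred hS hI.
Proof. by have [_ _ finS] := hS; apply: finS; exact: dyad_finite_rank. Qed.

Definition dyad x f : U := SOA (dyad_in_soa x f).

Lemma dyadE x f z : dyad x f z = f z *: x. Proof. reflexivity. Qed.

(** * Scalar operators *)

Definition is_scalar A : Prop := exists c, A = c *: (1 : U).

Lemma is_scalarD A B : is_scalar A -> is_scalar B -> is_scalar (A + B).
Proof. by move=> [a ->] [b ->]; exists (a + b); rewrite scalerDl. Qed.
Lemma is_scalarZ c A : is_scalar A -> is_scalar (c *: A).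
Proof. by move=> [a ->]; exists (c * a); rewrite scalerA. Qed.
Lemma is_scalarN A : is_scalar A -> is_scalar (- A).
Proof. by rewrite -scaleN1r; exact: is_scalarZ. Qed.
Lemma is_scalarB A B : is_scalar A -> is_scalar B -> is_scalar (A - B).
Proof. by move=> sA sB; apply/is_scalarD/is_scalarN. Qed.
Lemma is_scalar0 : is_scalar 0.
Proof. by exists 0; rewrite scale0r. Qed.

(** What the rank one arguments need of the Hahn-Banach theorem. *)
Definition separating : Prop := forall x, x != 0 -> exists f, f x = 1.

Hypothesis sep : separating.
Hypothesis hV : dim_ge V 2.

Lemma kernel_nontrivial g : exists2 y, y != 0 & g y = 0.
Proof.
have [e eP] := hV; set a := e ord0; set b := e ord_max.
have ind s t : s *: a + t *: b = 0 -> s = 0 /\ t = 0.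
  move=> st; pose c (i : 'I_2) := if i == ord0 then s else t.
  have /eP c0 : \sum_i c i *: e i = 0.
    by rewrite big_ord_recl big_ord1 /= (_ : lift ord0 ord0 = ord_max)//; apply: val_inj.
  by split; [exact: (c0 ord0)|exact: (c0 ord_max)].
have [ga|ga] := eqVneq (g a) 0.
  exists a => //; apply/eqP => a0; have [] := ind 1 0.
    by rewrite a0 scaler0 scale0r addr0.
  by move=> /eqP; rewrite oner_eq0.
exists (g b *: a - g a *: b); last by rewrite dualB !dualZ mulrC subrr.
apply: contra ga => /eqP; rewrite -scaleNr => /ind[_ /eqP].
by rewrite oppr_eq0.
Qed.

Lemma unit_pair_exists : exists x g, g x = 1.
Proof.
have [e eP] := hV; suff /sep[g ge] : e ord0 != 0 by exists (e ord0), g.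
apply/eqP => e0; have : \sum_i (i == ord0)%:R *: e i = 0.
  by rewrite big_ord_recl big_ord1 /= e0 scaler0 scale0r addr0.
by move=> /eP/(_ ord0)/eqP; rewrite eqxx oner_eq0.
Qed.

Lemma soa_scaler1_inj a b : a *: (1 : U) = b *: (1 : U) -> a = b.
Proof.
have [x [g gx]] := unit_pair_exists => /(congr1 (fun A : U => g (A x))).
by rewrite !soaE !linearZ /= gx !mulr1.
Qed.

(** Fix [x] and [g] with [g x = 1].  Commutation with [dyad v g], evaluated at
    [x], reads [T v = g (T x) *: v] with an eigenvalue independent of [v]; and
    the vectors [v] with [g v = 1] span the space. *)
Lemma commute_idempotents_is_scalar T :
  (forall x g, g x = 1 -> T * dyad x g = dyad x g * T) -> is_scalar T.
Proof.
have [x [g gx]] := unit_pair_exists => TC; exists (g (T x)).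
have gT v : g v = 1 -> T v = g (T x) *: v.
  move=> gv; have /(congr1 (fun A : U => A x)) := TC _ _ gv.
  by rewrite !soaE !dyadE gx !scale1r.
apply: soa_ext => v; rewrite !soaE.
have [gv|gv] := eqVneq (g v) 0.
  have := gT (v + x); rewrite linearD /= gv gx add0r => /(_ erefl).
  by rewrite linearD /= scalerDr -(gT _ gx) => /addIr.
have /gT : g ((g v)^-1 *: v) = 1 by rewrite linearZ /= mulVf.
by rewrite linearZ /= !scalerA mulrC -scalerA => /scalerI; apply; rewrite invr_eq0.
Qed.

(** The identity [lie T (A * T) = lie T A * T] says that a nonzero scalar
    times [T] is scalar, as soon as some [lie T A] does not vanish. *)
Lemma lie_is_scalar T : (forall A, is_scalar (lie T A)) -> is_scalar T.
Proof.
move=> sT; have [[A TA]|TC] := pselect (exists A, lie T A != 0).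
  have [c cE] := sT A; have [d dE] := sT (A * T).
  have c0 : c != 0 by apply: contra TA => /eqP c0; rewrite cE c0 scale0r.
  exists (c^-1 * d); rewrite -scalerA -dE.
  have -> : lie T (A * T) = lie T A * T by rewrite /lie mulrBl !mulrA.
  by rewrite cE -soa_scalerAl mul1r scalerA mulVf// scale1r.
apply: commute_idempotents_is_scalar => x g _; apply/eqP; rewrite -subr_eq0.
by apply/negPn/negP => h; apply: TC; exists (dyad x g).
Qed.

Lemma foldl_lie_is_scalar m T :
  (forall s : seq U, size s = m -> foldl (@lie U) T s = 0) -> is_scalar T.
Proof.
elim: m T => [|m IHm] T sT; first by have /= -> := sT [::] erefl; exact: is_scalar0.
apply: lie_is_scalar => A; apply: IHm => s sm.
by apply: (sT (A :: s)); rewrite /= sm.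
Qed.

(** * Commutators and affine maps *)

Lemma foldl_lieZ c T (s : seq U) :
  foldl (@lie U) (c *: T) s = c *: foldl (@lie U) T s.
Proof.
elim: s T => //= A s IHs T; rewrite -IHs; congr foldl.
by rewrite /lie -soa_scalerAl -soa_scalerAr -scalerBr.
Qed.

Lemma foldl_lie0 (s : seq U) : foldl (@lie U) 0 s = 0.
Proof. by rewrite -[X in foldl _ X](scale0r (0 : U)) foldl_lieZ scale0r. Qed.

Lemma lie_affinel c l A B : lie (c *: A + l *: (1 : U)) B = c *: lie A B.
Proof.
rewrite /lie mulrDl mulrDr -!soa_scalerAl -!soa_scalerAr mul1r mulr1 scalerBr.
by rewrite opprD addrACA subrr addr0.
Qed.

Lemma lie_affiner c l A B : lie A (c *: B + l *: (1 : U)) = c *: lie A B.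
Proof.
rewrite /lie mulrDl mulrDr -!soa_scalerAl -!soa_scalerAr mul1r mulr1 scalerBr.
by rewrite opprD addrACA subrr addr0.
Qed.

(** * Maps whose values almost commute with orthogonal elements *)

(** The common consequence of the two Lie conditions: if both products of
    [A] and [B] vanish, an iterated commutator that starts with [lie A B]
    is 0, whatever its further entries are. *)
Definition lie_orthogonal (phi : U -> U) : Prop :=
  forall A B, A * B = 0 -> B * A = 0 -> is_scalar (lie (phi A) B).

Section LieOrthogonal.
Variable phi : {linear U -> U}.
Hypothesis phiL : lie_orthogonal phi.

(** The commutator is a scalar [c], and compressing it by the idempotent
    [P = dyad x g] gives [c *: P] on one side, 0 on the other since
    [P * B = B * P = 0]. *)
Lemma commute_orthogonal x g B : g x = 1 ->
  dyad x g * B = 0 -> B * dyad x g = 0 ->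
  phi (dyad x g) * B = B * phi (dyad x g).
Proof.
set T := phi _ => gx PB BP; have [c cE] := phiL PB BP.
apply/eqP; rewrite -subr_eq0 -/(lie _ _) cE; apply/eqP.
have Bx : B x = 0.
  by have /(congr1 (fun A : U => A x)) := BP; rewrite soaE dyadE gx scale1r.
have gB v : g (B v) = 0.
  have /(congr1 (fun A : U => g (A v))) := PB.
  by rewrite soaE dyadE linearZ /= gx mulr1 linear0.
have /(congr1 (fun A : U => g (A x))) := cE.
rewrite /lie !soaE Bx linear0 sub0r linearN /= gB linearZ /= gx mulr1 oppr0.
by move=> <-; rewrite scale0r.
Qed.

Definition rank_one_idempotent P : Prop := exists x g, g x = 1 /\ P = dyad x g.

Lemma rank_one_idempotentM P : rank_one_idempotent P -> P * P = P.
Proof.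
move=> [x [g [gx ->]]]; apply: soa_ext => v.
by rewrite soaE !dyadE linearZ /= gx mulr1.
Qed.

(** With [P = dyad x g], the operator [phi P] commutes with [1 - P], so it
    preserves the line of [x] and the kernel of [g].  On the kernel it
    commutes with the rank one operators, so it acts there as a scalar. *)
Lemma rank_one_idempotent_affine P : rank_one_idempotent P ->
  exists l, is_scalar (phi P - l *: P).
Proof.
move=> [x [g [gx ->{P}]]]; set P := dyad x g; set T := phi P.
have PP : P * P = P by apply: rank_one_idempotentM; exists x, g.
have TP : T * P = P * T.
  have : T * (1 - P) = (1 - P) * T.
    by apply: commute_orthogonal; rewrite // (mulrBl, mulrBr) (mul1r, mulr1) PP subrr.
  by rewrite mulrBl mulrBr mul1r mulr1 => /addrI/oppr_inj.
have [t Tx] : exists t, T x = t *: x.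
  exists (g (T x)); have /(congr1 (fun A : U => A x)) := TP.
  by rewrite !soaE !dyadE gx !scale1r.
have [y y0 gy] := kernel_nontrivial g; have [h0 hy0] := sep y0.
(* [dyad v h] is orthogonal to [P] for all [v] in the kernel of [g] *)
have [h hE] := dual_lincomb (- h0 x) 1 g h0.
have hx : h x = 0 by rewrite hE gx mulr1 mul1r addNr.
have hy : h y = 1 by rewrite hE gy mulr0 mul1r add0r.
have Tv v : g v = 0 -> T v = h (T y) *: v.
  move=> gv; have : T * dyad v h = dyad v h * T.
    apply: commute_orthogonal; first by [].
      by apply: soa_ext => w; rewrite soaE !dyadE linearZ /= gv mulr0 scale0r.
    by apply: soa_ext => w; rewrite soaE !dyadE linearZ /= hx mulr0 scale0r.
  by move=> /(congr1 (fun A : U => A y)); rewrite !soaE !dyadE hy !scale1r.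
exists (t - h (T y)), (h (T y)); apply: soa_ext => w.
rewrite !soaE dyadE; have := Tv (w - g w *: x).
rewrite linearB linearZ /= gx mulr1 subrr => /(_ erefl).
rewrite linearB linearZ /= Tx => /eqP; rewrite subr_eq => /eqP ->.
rewrite scalerBl scalerBr !scalerA (mulrC (g w)) opprB -addrA.
by rewrite [X in _ + X]addrCA subrr addr0 subrK.
Qed.

(** If the difference of two idempotents [P] and [Q] squares to 0, their
    midpoint is idempotent.  Linearity of [phi] relates the coefficients of
    [P], [Q] and the midpoint by a relation [a *: P + b *: Q = k *: 1], and
    such a relation is trivial: with [N = Q - P], so that [P * N + N * P = N],
    multiplying it by [N] on the left and on the right and adding up gives
    [a + b = 2 * k]; compressing by [P] then gives [k = 0]. *)
Lemma rank_one_idempotent_slope_eq P Q lP lQ :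
  rank_one_idempotent P -> rank_one_idempotent Q ->
  rank_one_idempotent (2^-1 *: (P + Q)) -> (P - Q) * (P - Q) = 0 -> P != Q ->
  is_scalar (phi P - lP *: P) -> is_scalar (phi Q - lQ *: Q) -> lP = lQ.
Proof.
move=> rP rQ rM NN neqPQ [cP phiP] [cQ phiQ].
have [l [c phiM]] := rank_one_idempotent_affine rM.
have phiD A B : phi (A + B) = phi A + phi B by exact: linearD.
have phiZ d A : phi (d *: A) = d *: phi A by exact: linearZ.
have PP := rank_one_idempotentM rP; have QQ := rank_one_idempotentM rQ.
set N : U := Q - P; have N0 : N != 0 by rewrite subr_eq0 eq_sym.
have {}NN : N * N = 0 by rewrite /N -opprB mulrNN.
have QE : Q = P + N by rewrite addrC subrK.
clearbody N.
have PN : P * N + N * P = N.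
  apply: (addrI P); rewrite -[RHS]QE -[RHS]QQ QE mulrDl !mulrDr PP NN addr0.
  by rewrite addrA.
have PNP : P * (N * P) = 0.
  apply: (addrI (P * N)); rewrite addr0.
  by have /(congr1 (fun A => P * A)) := PN; rewrite mulrDr mulrA PP.
pose a := lP - l; pose b := lQ - l.
have comb (u v : K) : (u *: P + v *: Q : U) = (u + v) *: P + v *: N.
  by rewrite QE scalerDr addrA scalerDl.
have phiPQ : phi P + phi Q - l *: (P + Q) = (2 * c) *: (1 : U).
  have two : 2 * 2^-1 = 1 :> K by rewrite mulfV ?pnatr_eq0.
  rewrite -scalerA -phiM phiZ phiD [RHS]scalerBr !scalerA mulrAC two.
  by rewrite scale1r mul1r.
have [k kE] : is_scalar ((a + b) *: P + b *: N).
  exists (2 * c - cP - cQ).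
  rewrite -comb !scalerBl -phiPQ -phiP -phiQ.
  rewrite scalerDr !opprB -[RHS]addrA [X in _ = _ + X]addrACA -opprD.
  by rewrite [RHS]addrC [RHS]addrA subrK opprD addrACA.
have NE : (a + b - 2 * k) *: N = 0.
  have h1 : (a + b) *: (N * P) = k *: N.
    have /(congr1 (fun A => N * A)) := kE.
    by rewrite mulrDr -!soa_scalerAr NN scaler0 addr0 mulr1.
  have h2 : (a + b) *: (P * N) = k *: N.
    have /(congr1 (fun A => A * N)) := kE.
    by rewrite mulrDl -!soa_scalerAl NN scaler0 addr0 mul1r.
  by rewrite scalerBl -[in X in X - _]PN scalerDr h1 h2 mulr_natl mulr2n scalerDl subrr.
have ab : a + b = 2 * k.
  by move/eqP: NE; rewrite scaler_eq0 (negPf N0) orbF subr_eq0 => /eqP.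
have kP : k *: P = 0.
  have /(congr1 (fun A => P * (A * P))) := kE.
  rewrite ab mulrDl mulrDr -!soa_scalerAl -!soa_scalerAr PNP PP PP scaler0 mul1r.
  by rewrite PP addr0 mulr_natl mulr2n scalerDl => /(canRL (addrK _)); rewrite subrr.
have k0 : k = 0.
  have : k *: N = 0.
    by rewrite -PN scalerDr soa_scalerAl soa_scalerAr kP mul0r mulr0 addr0.
  by move/eqP; rewrite scaler_eq0 (negPf N0) orbF => /eqP.
have b0 : b = 0.
  move: kE; rewrite ab k0 mulr0 !scale0r add0r => /eqP.
  by rewrite scaler_eq0 (negPf N0) orbF => /eqP.
move: ab; rewrite b0 k0 mulr0 addr0 => a0.
by rewrite (subr0_eq a0) (subr0_eq b0).
Qed.

(** Idempotents with a common vector, or with a common functional, differ by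
    an element of square 0, so the previous lemma compares them.  Two
    arbitrary idempotents are joined by such steps through a vector [z] at
    which neither functional vanishes. *)
Lemma rank_one_idempotent_slope :
  exists l, forall P, rank_one_idempotent P -> is_scalar (phi P - l *: P).
Proof.
pose slope P := xget 0 [set l | is_scalar (phi P - l *: P)]%classic.
have slopeP P : rank_one_idempotent P -> is_scalar (phi P - slope P *: P).
  by move=> /rank_one_idempotent_affine/(@xgetPex K 0 _).
have slope_vector x y g : g x = 1 -> g y = 1 ->
    slope (dyad x g) = slope (dyad y g).
  move=> gx gy; have [->//|neq] := eqVneq (dyad x g) (dyad y g).
  apply: rank_one_idempotent_slope_eq neq (slopeP _ _) (slopeP _ _).
  - by exists x, g.
  - by exists y, g.
  - exists (2^-1 *: (x + y)), g; split; first by rewrite dualZ dualD gx gy; field.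
    by apply: soa_ext => v; rewrite !soaE !dyadE -!scalerDr !scalerA mulrC.
  - apply: soa_ext => v; rewrite !soaE !dyadE !dualB !dualZ gx gy.
    by rewrite !mulr1 !subrr !scale0r subrr.
  - by exists x, g.
  - by exists y, g.
have slope_functional x f g : f x = 1 -> g x = 1 ->
    slope (dyad x f) = slope (dyad x g).
  move=> fx gx; have [->//|neq] := eqVneq (dyad x f) (dyad x g).
  have [m mE] := dual_lincomb 2^-1 2^-1 f g.
  apply: rank_one_idempotent_slope_eq neq (slopeP _ _) (slopeP _ _).
  - by exists x, f.
  - by exists x, g.
  - exists x, m; split; first by rewrite mE fx gx; field.
    by apply: soa_ext => v; rewrite !soaE !dyadE mE scalerDr !scalerA -scalerDl.
  - apply: soa_ext => v; rewrite !soaE !dyadE !dualB !dualZ fx gx.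
    by rewrite !mulr1 subrr.
  - by exists x, f.
  - by exists x, g.
have slope_common x y f g : f x = 1 -> g y = 1 ->
    slope (dyad x f) = slope (dyad y g).
  move=> fx gy.
  have [z [fz gz]] : exists z, f z != 0 /\ g z != 0.
    have [fy|fy] := eqVneq (f y) 0; last by exists y; rewrite fy gy oner_eq0.
    have [gx|gx] := eqVneq (g x) 0; last by exists x; rewrite gx fx oner_eq0.
    by exists (x + y); rewrite !dualD fx fy gx gy addr0 add0r oner_eq0.
  (* [h] is [g] rescaled to take at [z / f z] the value 1, as [f] does *)
  have [h hE] := dual_lincomb (f z / g z) 0 g g.
  have {}hE v : h v = f z / g z * g v by rewrite hE mul0r addr0.
  transitivity (slope (dyad ((f z)^-1 *: z) f)).
    by apply: slope_vector; rewrite // dualZ mulVf.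
  transitivity (slope (dyad ((f z)^-1 *: z) h)).
    by apply: slope_functional; rewrite ?hE dualZ ?mulVf//; field; rewrite ?fz ?gz.
  transitivity (slope (dyad ((g z)^-1 *: z) g)).
    congr slope; apply: soa_ext => v; rewrite !dyadE hE !scalerA; congr (_ *: _).
    by field; rewrite ?fz ?gz.
  by apply: slope_vector; rewrite // dualZ mulVf.
have [x [g gx]] := unit_pair_exists.
exists (slope (dyad x g)) => _ [y [h [hy ->]]].
by rewrite (slope_common _ y _ h)//; apply: slopeP; exists y, h.
Qed.

(** Up to a factor, a rank one operator is an idempotent, or, when it is
    nilpotent, a difference of two idempotents with the same range. *)
Lemma scalar_on_dyads :
  (forall P, rank_one_idempotent P -> is_scalar (phi P)) ->
  forall x f, is_scalar (phi (dyad x f)).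
Proof.
move=> phiP x f.
have dyadP y g : g y = 1 -> is_scalar (phi (dyad y g)).
  by move=> gy; apply: phiP; exists y, g.
have [->|x0] := eqVneq x 0.
  rewrite (_ : dyad 0 f = 0) ?linear0; first exact: is_scalar0.
  by apply: soa_ext => v; rewrite dyadE scaler0.
have [fx|fx] := eqVneq (f x) 0; last first.
  rewrite (_ : dyad x f = f x *: dyad ((f x)^-1 *: x) f).
    by rewrite linearZ; apply/is_scalarZ/dyadP; rewrite dualZ mulVf.
  apply: soa_ext => v; rewrite soaE !dyadE !scalerA; congr (_ *: _).
  by field; rewrite fx.
have [g gx] := sep x0; have [h hE] := dual_lincomb 1 1 f g.
rewrite (_ : dyad x f = dyad x h - dyad x g).
  by rewrite linearB; apply: is_scalarB; apply: dyadP; rewrite // hE fx gx mulr0 mulr1 add0r.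
by apply: soa_ext => v; rewrite !soaE !dyadE hE !mul1r scalerDl addrK.
Qed.

(** For a rank one idempotent [P], the corner [C = (1 - P) * A * (1 - P)]
    differs from [A] by operators of finite rank, whose images are scalar.
    Since [C] is orthogonal to [P], the image of [C], hence that of [A],
    commutes with [P]; and [P] is arbitrary. *)
Lemma scalar_on_idempotents_is_scalar :
  (forall P, rank_one_idempotent P -> is_scalar (phi P)) ->
  forall A, is_scalar (phi A).
Proof.
move=> phiP A; have phiD := scalar_on_dyads phiP.
apply: commute_idempotents_is_scalar => x g gx.
have PP : dyad x g * dyad x g = dyad x g.
  by apply: rank_one_idempotentM; exists x, g.
set P := dyad x g in PP *; pose C := (1 - P) * A * (1 - P).
have [f fE] := dual_comp g A.
have CE v : C v = A v - (g v *: A x + (f v - g v * g (A x)) *: x).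
  by rewrite opprD addrA /C !soaE !dyadE linearB linearZ /= fE dualB dualZ.
have oneB_P : (1 - P) * P = 0 by rewrite mulrBl mul1r PP subrr.
have P_oneB : P * (1 - P) = 0 by rewrite mulrBr mulr1 PP subrr.
have CP : C * P = 0 by rewrite /C -mulrA oneB_P mulr0.
have PC : P * C = 0 by rewrite /C !mulrA P_oneB !mul0r.
clearbody C.
have [c cE] : is_scalar (phi (A - C)).
  rewrite (_ : A - C = dyad x f + dyad (A x) g - g (A x) *: P).
    rewrite linearB linearD linearZ /=.
    apply: is_scalarB; [apply: is_scalarD; exact: phiD|apply: is_scalarZ; exact: phiD].
  apply: soa_ext => v; rewrite !soaE CE subKr !dyadE scalerBl addrA.
  by rewrite scalerA (mulrC (g (A x))) [X in X - _]addrC.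
suff : phi C * P = P * phi C.
  rewrite -[A](subrK C) linearD /= cE mulrDl mulrDr => ->.
  by rewrite -soa_scalerAl -soa_scalerAr mul1r mulr1.
have [d dE] := phiL CP PC.
have : d *: P = 0.
  have /(congr1 (fun B => P * B * P)) := dE.
  rewrite /lie mulrBr mulrBl -!mulrA PP [P * (P * _)]mulrA PP subrr.
  by rewrite -soa_scalerAl -soa_scalerAr mul1r PP => <-.
move=> /eqP; rewrite scaler_eq0 => /orP[/eqP d0|/eqP P0]; last first.
  by rewrite P0 mulr0 mul0r.
by apply/eqP; rewrite -subr_eq0 -/(lie _ _) dE d0 scale0r.
Qed.

End LieOrthogonal.

(** Subtracting from [phi] its common slope [l] on the idempotents leaves a
    map that is still [lie_orthogonal], because [lie A B = 0] for
    orthogonal [A] and [B]. *)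
Lemma lie_orthogonal_affine (phi : {linear U -> U}) : lie_orthogonal phi ->
  exists (l : K) (mu : {scalar U}), forall A, phi A = l *: A + mu A *: (1 : U).
Proof.
move=> phiL; have [l phiP] := rank_one_idempotent_slope phiL.
pose psi : {linear U -> U} := phi \- (l \*: idfun).
have psiE A : psi A = phi A - l *: A by [].
have psiL : lie_orthogonal psi.
  move=> A B AB BA; have [c cE] := phiL A B AB BA; exists c; rewrite -cE.
  rewrite /lie psiE mulrBl mulrBr -soa_scalerAl -soa_scalerAr AB BA scaler0.
  by rewrite !subr0.
have psi_scalar A : is_scalar (psi A).
  exact: scalar_on_idempotents_is_scalar psiL phiP A.
have [x [g gx]] := unit_pair_exists; pose mu A := g (psi A x).
have mu_scalar : scalar mu.
  move=> a A B; rewrite /mu; have -> : psi (a *: A + B) = a *: psi A + psi B.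
    exact: linearP.
  by rewrite soaDE soaZE dualD dualZ.
pose muL := GRing.isLinear.Build K U K *%R mu mu_scalar.
exists l, (HB.pack_for {scalar U} mu muL) => A /=.
have [c cE] := psi_scalar A.
by rewrite /mu cE soaZE soa1E dualZ gx mulr1 -cE psiE addrC subrK.
Qed.

(** * The two Lie conditions *)

Variable phi : {linear U -> U}.

Lemma condNl_lie_orthogonal n : (2 <= n)%N -> condNl n phi -> lie_orthogonal phi.
Proof.
move=> n2 phiN A B AB BA; apply: (@foldl_lie_is_scalar (n - 2)) => s sn.
have /= <- := phiN A B s; first by rewrite /lie AB BA subrr foldl_lie0 linear0.
  by rewrite /= sn -addn2 subnK.
by rewrite !big_cons mulrA AB mul0r.
Qed.

Lemma condNr_lie_orthogonal n : (2 <= n)%N -> condNr n phi -> lie_orthogonal phi.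
Proof.
move=> n2 phiN A B AB BA; apply: (@foldl_lie_is_scalar (n - 2)) => s sn.
have -> : lie (phi A) B = -1 *: lie B (phi A) by rewrite scaleN1r /lie opprB.
rewrite foldl_lieZ; have /= <- := phiN B A s.
- by rewrite /lie AB BA subrr foldl_lie0 linear0 scaler0.
- by rewrite /= sn -addn2 subnK.
- by rewrite !big_cons mulrA BA mul0r.
Qed.

Section AffineForm.
Variables (n : nat) (l : K) (mu : {scalar U}).
Hypothesis n2 : (2 <= n)%N.
Hypothesis phiE : forall A, phi A = l *: A + mu A *: (1 : U).

Definition vanishes_on_lie_polys : Prop := forall s : seq U,
  size s = n -> \prod_(A <- s) A = 0 -> mu (lie_poly s) = 0.

(** Scalars are central, so for [phi = l id + mu] replacing [A] or [B] by its
    image multiplies the iterated commutator by [l], while [phi] of the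
    commutator has the extra term [mu]: each Lie condition says that this
    term vanishes. *)
Lemma vanishes_on_lie_polysP : vanishes_on_lie_polys <->
  forall A B (s : seq U), size [:: A, B & s] = n ->
    \prod_(C <- [:: A, B & s]) C = 0 ->
    phi (lie_poly [:: A, B & s]) = l *: lie_poly [:: A, B & s].
Proof.
split=> [mu0 A B s sn s0|phil s sn s0].
  by rewrite phiE mu0// scale0r addr0.
apply: soa_scaler1_inj; apply: (addrI (l *: lie_poly s)).
rewrite -phiE scale0r addr0; move: n2 sn s0.
by case: s => [|A [|B s]] /= n2' sn s0; [rewrite -sn in n2'..|exact: phil].
Qed.

Lemma affine_condNlP : condNl n phi <-> vanishes_on_lie_polys.
Proof.
have affl A B (s : seq U) :
    lie_poly [:: phi A, B & s] = l *: lie_poly [:: A, B & s].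
  by rewrite /lie_poly /= phiE lie_affinel foldl_lieZ.
rewrite vanishes_on_lie_polysP.
by split=> phiN A B s sn s0; rewrite phiN// affl.
Qed.

Lemma affine_condNrP : condNr n phi <-> vanishes_on_lie_polys.
Proof.
have affr A B (s : seq U) :
    lie_poly [:: A, phi B & s] = l *: lie_poly [:: A, B & s].
  by rewrite /lie_poly /= phiE lie_affiner foldl_lieZ.
rewrite vanishes_on_lie_polysP.
by split=> phiN A B s sn s0; rewrite phiN// affr.
Qed.

End AffineForm.

End StandardOperatorAlgebra.

(** * The equivalence *)

Theorem theorem4p3 (R : realType) (X : completeNormedModType R[i])
  (hX : dim_ge X 2)
  (S : {pred bop X}) (hS : standard_operator_algebra S) (hI : 1 \in S)
  (n : nat) (hn : (2 <= n)%N)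
  (phi : {linear soa hS hI -> soa hS hI}) :
  [<-> condN n phi;
       condNl n phi;
       condNr n phi;
       exists (lambda : R[i]) (mu : {scalar soa hS hI}),
         (forall A : soa hS hI, phi A = lambda *: A + mu A *: (1 : soa hS hI)) /\
         (forall s : seq (soa hS hI),
            size s = n -> \prod_(A <- s) A = 0 -> mu (lie_poly s) = 0)].
Proof.
have sep : separating X.
  move=> x /bounded_functional_exists[f [flin fbd fx]].
  by exists (Dual flin fbd).
have affine := lie_orthogonal_affine sep hX (phi := phi).
have Nl_of := condNl_lie_orthogonal sep hX (phi := phi) hn.
have Nr_of := condNr_lie_orthogonal sep hX (phi := phi) hn.
have NlP := @affine_condNlP _ _ _ hS hI sep hX phi n _ _ hn.
have NrP := @affine_condNrP _ _ _ hS hI sep hX phi n _ _ hn.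
tfae.
- by case.
- move=> phiN; have [l [mu phiE]] := affine (Nl_of phiN).
  by apply/(NrP _ _ phiE)/(NlP _ _ phiE).
- move=> phiN; have [l [mu phiE]] := affine (Nr_of phiN).
  by exists l, mu; split=> //; apply/(NrP _ _ phiE).
- move=> [l [mu [phiE mu0]]].
  by split; [apply/(NlP _ _ phiE)|apply/(NrP _ _ phiE)].
Qed.
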